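(* Consider the marker-and-cell (staggered grid) discretization on a rectangle, with any of the following boundary conditions: purely Dirichlet, periodic in $x$ and Dirichlet in $y$, or purely periodic. Let $G$ be the discrete gradient, $D=-G^*$ the discrete divergence and $L^c=DG$ the discrete pressure Laplacian (see the context), and let $\mathbf P$ be the space of mean-zero pressures, on which $L^c$ is invertible. In the inviscid case, when the discrete unsteady Stokes operator degenerates to the mixed form of an elliptic operator, the operators $$M=\begin{bmatrix}I&G\\-D&0\end{bmatrix},\qquad P_1^{-1}=\begin{bmatrix}I&-G\\0&I\end{bmatrix}\begin{bmatrix}I&0\\0&(-L^c)^{-1}\end{bmatrix}\begin{bmatrix}I&0\\-D&-I\end{bmatrix}\begin{bmatrix}I^{-1}&0\\0&I\end{bmatrix}$$ on $\mathbf U\times\mathbf P$ satisfy $$P_1^{-1}M=\begin{bmatrix}I&0\\0&I\end{bmatrix},$$ whichever of these types of boundary conditions is imposed.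
   Context: The rectangle is divided into $n_x\times n_y$ square cells of side $h>0$, $n_x,n_y\ge2$. For $m\ge2$, $B_D^{(m)}$ is the $m\times(m-1)$ matrix with entries $-1$ on the main diagonal, $1$ on the first subdiagonal and $0$ elsewhere, and $B_P^{(m)}$ is the $m\times m$ circulant matrix $I-C$, where $C_{i,i+1}=1$ with indices mod $m$. Pressures are vectors in $\mathbb R^{n_xn_y}$ (cell-centered values, lexicographic order with $x$ index fastest), and $\mathbf P$ is the subspace of those with mean value $0$. The operator $-D=G^*:\mathbf U\to\mathbf P$ is $\frac1h[\,I_{n_y}\otimes B_x\ \ \ B_y\otimes I_{n_x}\,]$, where $B_x=B_D^{(n_x)}$ if the boundary condition in the $x$-direction is Dirichlet and $B_x=B_P^{(n_x)}$ if it is periodic, and likewise $B_y=B_D^{(n_y)}$ or $B_P^{(n_y)}$ for the $y$-direction; $\mathbf U$ is the corresponding space of face-centered velocity vectors (the domain of this matrix). $G=(G^* )^T$ restricted to $\mathbf P$. $P_1$ is the pressure-correction projection method preconditioner: for $A=I-\epsilon^2L$ with $L$ the discrete vector Laplacian and $\epsilon^2=\mu\Delta t/\rho$ (viscosity $\mu$, time step $\Delta t$, density $\rho$), it is $P_1^{-1}=\begin{bmatrix}I&-G\\0&I-\epsilon^2L^c\end{bmatrix}\begin{bmatrix}I&0\\0&(-L^c)^{-1}\end{bmatrix}\begin{bmatrix}I&0\\-D&-I\end{bmatrix}\begin{bmatrix}A^{-1}&0\\0&I\end{bmatrix}$, and the inviscid case is $\epsilon=0$. *)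

(* Defs.v *)
From HB Require Import structures.
From mathcomp Require Import all_boot all_order all_algebra.
From mathcomp Require Import mxtens.

Set Implicit Arguments.
Unset Strict Implicit.
Unset Printing Implicit Defensive.

Import Order.TTheory GRing.Theory Num.Theory.
Local Open Scope ring_scope.

Inductive direction_bc := Dirichlet | Periodic.

Inductive boundary_condition :=
  | PurelyDirichlet
  | PeriodicXDirichletY
  | PurelyPeriodic.

Definition bc_x (bc : boundary_condition) : direction_bc :=
  match bc with
  | PurelyDirichlet => Dirichlet
  | PeriodicXDirichletY => Periodic
  | PurelyPeriodic => Periodic
  end.

Definition bc_y (bc : boundary_condition) : direction_bc :=
  match bc with
  | PurelyDirichlet => Dirichlet
  | PeriodicXDirichletY => Dirichlet
  | PurelyPeriodic => Periodic
  end.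

Section Grid1D.
Variable R : realFieldType.

Definition B_D (m : nat) : 'M[R]_(m, m.-1) :=
  \matrix_(i, j) (if i == j :> nat then -1
                  else if i == j.+1 :> nat then 1 else 0).

Definition B_P (m : nat) : 'M[R]_m :=
  1%:M - \matrix_(i, j) (if j == (i.+1 %% m)%N :> nat then 1 else 0).

(* Number of unknown face velocities along a line of m cells: the boundary
   faces carry no unknown in the Dirichlet case. *)
Definition nfaces (b : direction_bc) (m : nat) : nat :=
  match b with Dirichlet => m.-1 | Periodic => m end.

Definition B (b : direction_bc) (m : nat) : 'M[R]_(m, nfaces b m) :=
  match b with Dirichlet => B_D m | Periodic => B_P m end.

Lemma B_col_sum b m j : \sum_i B b m i j = 0.
Proof.
case: b j => /= j.
  have ltj : (j.+1 < m)%N by rewrite -ltn_predRL.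
  have ltj' : (j < m)%N by apply: ltn_trans ltj.
  rewrite (bigD1 (Ordinal ltj')) //= (bigD1 (Ordinal ltj)) /=; last first.
    by rewrite -val_eqE /= gtn_eqF.
  rewrite !mxE /= !eqxx gtn_eqF // big1 ?addr0 ?addNr // => i.
  rewrite -!val_eqE /= => /andP[/negPf ne1 /negPf ne2].
  by rewrite mxE ne1 ne2.
case: m j => [[]//|m] j.
under eq_bigr do rewrite !mxE.
have eqS (i : 'I_m.+1) : (j == (i.+1 %% m.+1)%N :> nat) = (i == ord_pred j).
  rewrite -[(i.+1 %% m.+1)%N]/(val (ordS i)) val_eqE.
  by rewrite -(inj_eq (can_inj (@ordSK m.+1))) ord_predK eq_sym.
rewrite sumrB (bigD1 j) //= eqxx big1 ?addr0 => [|i /negPf->//].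
rewrite (bigD1 (ord_pred j)) // eqS eqxx big1 /= ?addr0 ?subrr // => i /negPf ne.
by rewrite eqS ne.
Qed.

End Grid1D.

Section MAC.
Variables (R : realFieldType) (bc : boundary_condition) (nx ny : nat) (h : R).

(* With the x index fastest, cell (i, j) has index j * nx + i, which is the
   ordering of 'I_(ny * nx) used by the Kronecker product *t. *)
Local Notation pressure := 'cV[R]_(ny * nx).

Definition mean_pressure (p : pressure) : R^o :=
  (\sum_i p i 0) / (ny * nx)%:R.

Lemma mean_pressure_is_linear : linear mean_pressure.
Proof.
move=> a p q; rewrite /mean_pressure -[a *: (_ / _)]/(a * (_ / _)) mulrA -mulrDl mulr_sumr.
by rewrite -big_split; congr (_ / _); apply: eq_bigr => i _; rewrite !mxE.
Qed.

HB.instance Definition _ :=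
  GRing.isSemilinear.Build R pressure R^o _ mean_pressure
    (GRing.semilinear_linear mean_pressure_is_linear).

Definition mean_zero : {vspace pressure} := lker (linfun mean_pressure).

Lemma mem_mean_zero p : (p \in mean_zero) = (mean_pressure p == 0).
Proof. by rewrite memv_ker lfunE. Qed.

Definition P_space := subvs_of mean_zero.

Definition U_dim : nat := (ny * nfaces (bc_x bc) nx + nfaces (bc_y bc) ny * nx)%N.

Definition U_space := 'cV[R]_U_dim.

HB.instance Definition _ := Vector.on P_space.
HB.instance Definition _ := Vector.on U_space.

Definition Gstar_mx : 'M[R]_(ny * nx, U_dim) :=
  h^-1 *: row_mx (1%:M *t B R (bc_x bc) nx) (B R (bc_y bc) ny *t 1%:M).

Lemma Gstar_mx_mean_zero (u : U_space) : Gstar_mx *m u \in mean_zero.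
Proof.
have tens0 m n p q (A : 'M[R]_(m, n)) (C : 'M[R]_(p, q)) j :
    \sum_i (A *t C) i j = (\sum_i A i (mxtens_unindex j).1)
                          * (\sum_i C i (mxtens_unindex j).2).
  by rewrite mulr_sum; apply: eq_bigr => i _; rewrite mxE.
have col0 j : \sum_i Gstar_mx i j = 0.
  under eq_bigr do rewrite mxE.
  rewrite -mulr_sumr -(splitK j); case: (split j) => k /=.
    under eq_bigr do rewrite row_mxEl.
    by rewrite tens0 B_col_sum !mulr0.
  under eq_bigr do rewrite row_mxEr.
  by rewrite tens0 B_col_sum mul0r mulr0.
rewrite mem_mean_zero /mean_pressure; under eq_bigr do rewrite mxE.
rewrite exchange_big big1 ?mul0r // => j _.
by rewrite -mulr_suml col0 mul0r.
Qed.

Definition Gstar_fun (u : U_space) : P_space := Subvs (Gstar_mx_mean_zero u).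

Lemma Gstar_fun_is_linear : linear Gstar_fun.
Proof.
by move=> a u v; apply: val_inj; rewrite /= mulmxDr -scalemxAr.
Qed.

HB.instance Definition _ :=
  GRing.isSemilinear.Build R U_space P_space _ Gstar_fun
    (GRing.semilinear_linear Gstar_fun_is_linear).

Definition Gstar : 'Hom(U_space, P_space) := linfun Gstar_fun.

Definition gradient_fun (p : P_space) : U_space := Gstar_mx^T *m vsval p.

Lemma gradient_fun_is_linear : linear gradient_fun.
Proof. by move=> a p q; rewrite /gradient_fun !linearP. Qed.

HB.instance Definition _ :=
  GRing.isSemilinear.Build R P_space U_space _ gradient_fun
    (GRing.semilinear_linear gradient_fun_is_linear).

Definition gradient : 'Hom(P_space, U_space) := linfun gradient_fun.

Definition divergence : 'Hom(U_space, P_space) := - Gstar.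

Definition Lc : 'End(P_space) := (divergence \o gradient)%VF.

Lemma val_Gstar u : vsval (Gstar u) = Gstar_mx *m u.
Proof. by rewrite lfunE. Qed.

Lemma gradientE p : gradient p = Gstar_mx^T *m vsval p.
Proof. by rewrite lfunE. Qed.

End MAC.

Section BlockOperators.
Variables (R : realFieldType) (V W : vectType R).

Definition block_fun (a : 'End(V)) (b : 'Hom(W, V))
    (c : 'Hom(V, W)) (d : 'End(W)) (z : (V * W)%type) : (V * W)%type :=
  (a z.1 + b z.2, c z.1 + d z.2).

Lemma block_fun_is_linear a b c d : linear (block_fun a b c d).
Proof.
move=> k y z; rewrite /block_fun /= !linearP; congr (_, _) => /=;
by rewrite scalerDr addrACA.
Qed.

HB.instance Definition _ a b c d :=
  GRing.isSemilinear.Build R (V * W)%type (V * W)%type _ (block_fun a b c d)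
    (GRing.semilinear_linear (block_fun_is_linear a b c d)).

(* The operator [a b; c d] on V * W. *)
Definition block_op a b c d : 'End((V * W)%type) := linfun (block_fun a b c d).

Lemma block_opE a b c d z :
  block_op a b c d z = (a z.1 + b z.2, c z.1 + d z.2).
Proof. by rewrite lfunE. Qed.

End BlockOperators.

Section ProjectionMethod.
Variables (R : realFieldType) (bc : boundary_condition) (nx ny : nat) (h : R).

Local Notation G := (gradient bc nx ny h).
Local Notation D := (divergence bc nx ny h).
Local Notation L := (Lc bc nx ny h).

Definition M_op := block_op \1%VF G (- D) 0.

(* f^-1 on 'End is the two-sided inverse of f when f is bijective. *)
Definition P1_inv :=
  (block_op \1 (- G) 0 \1
   \o (block_op \1 0 0 (- L)^-1
   \o (block_op \1 0 (- D) (- \1)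
   \o  block_op (\1)^-1 0 0 \1)))%VF.

End ProjectionMethod.

(* Main.v *)
Require Import Defs.
From mathcomp Require Import all_boot all_order all_algebra.
From mathcomp Require Import mxtens.
Import Order.TTheory GRing.Theory Num.Theory.
Local Open Scope ring_scope.

(** The composition [P1_inv \o M_op] is a formal block computation as soon as
    [Lc] is injective.  For the latter, [Lc p = - G^* (G p)], so [Lc p = 0]
    gives [|G p|^2 = <p, G^* G p> = 0].  Each one-dimensional [B^T] only kills
    constants, hence [G p = 0] makes [p] constant along every grid row and
    column, hence constant, and its mean value is zero. *)

Lemma trmx_mul_self_eq0 (R : realDomainType) n (w : 'cV[R]_n) :
  w^T *m w = 0 -> w = 0.
Proof.
move=> /matrixP/(_ 0 0); rewrite !mxE => /eqP.
under eq_bigr do rewrite mxE -expr2.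
rewrite psumr_eq0 => [/allP w0|i _]; last exact: sqr_ge0.
apply/colP => i; rewrite mxE; apply/eqP.
by have := w0 i (mem_index_enum i); rewrite sqrf_eq0.
Qed.

Lemma mulmx_trmx_ker (R : realDomainType) m n (A : 'M[R]_(m, n))
    (p : 'cV[R]_m) :
  A *m (A^T *m p) = 0 -> A^T *m p = 0.
Proof.
move=> Ap0; apply: trmx_mul_self_eq0.
by rewrite trmx_mul trmxK -mulmxA Ap0 mulmx0.
Qed.

Lemma ord_step_const (T : Type) m (v : 'I_m -> T) :
  (forall i j : 'I_m, j = i.+1 :> nat -> v i = v j) -> forall i j, v i = v j.
Proof.
case: m v => [|m] v vS; first by case.
suff v0 i : v i = v ord0 by move=> i j; rewrite !v0.
case: i; elim=> [|k IHk] ltk; first by congr v; apply: val_inj.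
by rewrite -(vS (Ordinal (ltnW ltk)) (Ordinal ltk)) // IHk.
Qed.

(** Column [k] of [B_D] pairs with [v] to [v (k + 1) - v k], and column [k] of [B_P] to [v k] minus
    its cyclic predecessor, so consecutive entries agree. *)
Lemma B_ker_const (R : realFieldType) b m (v : 'I_m -> R) :
  (forall k, \sum_i B R b m i k * v i = 0) -> forall i j, v i = v j.
Proof.
case: b => /= Bv0; apply: ord_step_const => i j eqj.
  have lti : (i < m.-1)%N by rewrite ltn_predRL -eqj.
  have := Bv0 (Ordinal lti).
  have neij : j != i by rewrite -val_eqE /= eqj gtn_eqF.
  rewrite (bigD1 i) //= (bigD1 j) //= !mxE /= eqxx eqj eqxx gtn_eqF //.
  rewrite big1 ?addr0 => [|k /andP[nei nej]].
    by rewrite mulN1r mul1r addrC => /subr0_eq.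
  rewrite !mxE /=; move: nei nej; rewrite -!val_eqE /= eqj.
  by move=> /negPf-> /negPf->; rewrite mul0r.
(* Periodic case: column [j = i + 1] of [I - C] yields [v j - v i]. *)
have := Bv0 j; under eq_bigr do rewrite !mxE mulrBl.
rewrite sumrB (bigD1 j) //= eqxx mul1r big1 ?addr0; last first.
  by move=> k /negPf->; rewrite mul0r.
rewrite (bigD1 i) //= modn_small -?eqj // eqxx mul1r big1 ?addr0.
  by move/subr0_eq.
move=> k neki; case: eqP => [eqk|_]; last by rewrite mul0r.
case/eqP: neki; apply: val_inj => /=; move: eqk.
(* Here [j = (k + 1) mod m]. Without wrap-around this forces [k = i]; with it [j = 0], which
   contradicts [j = i + 1]. *)
have [lek|] := ltnP k.+1 m; first by rewrite modn_small // eqj => -[].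
move=> gek; suff -> : k.+1 = m by rewrite modnn eqj.
by apply/eqP; rewrite eqn_leq ltn_ord.
Qed.

Lemma sum_mxtens_index (V : nmodType) m n (F : 'I_(m * n) -> V) :
  \sum_i F i = \sum_i \sum_j F (mxtens_index (i, j)).
Proof.
rewrite pair_big (reindex (@mxtens_index m n)) /=.
  by apply: eq_bigr => -[].
by exists (@mxtens_unindex m n) => ? _; rewrite ?mxtens_indexK ?mxtens_unindexK.
Qed.

(** The two blocks decouple: one applies [B^T] along each grid row, the other along each grid
    column. Any two cells are then linked through a corner cell. *)
Lemma Gstar_mx_ker_const (R : realFieldType) bc nx ny (h : R)
    (p : 'cV[R]_(ny * nx)) :
  h != 0 -> (Gstar_mx bc nx ny h)^T *m p = 0 -> forall i j, p i 0 = p j 0.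
Proof.
move=> h0; rewrite /Gstar_mx linearZ /= -scalemxAl => /eqP.
rewrite scaler_eq0 invr_eq0 (negPf h0) /= tr_row_mx mul_col_mx -col_mx0.
move=> /eqP/eq_col_mx[/colP px /colP py].
have constx y x x' : p (mxtens_index (y, x)) 0 = p (mxtens_index (y, x')) 0.
  apply: (@B_ker_const R (bc_x bc) nx (fun i => p (mxtens_index (y, i)) 0)) => k.
  have := px (mxtens_index (y, k)); rewrite !mxE sum_mxtens_index => pk.
  (* The identity tensor factor leaves only the terms of grid row [y]. *)
  rewrite -{}[RHS]pk (bigD1 y) //= [X in _ + X]big1 ?addr0 => [|j /negPf nej].
    by apply: eq_bigr => i _; rewrite mxE tensmxE mxE eqxx mul1r.
  by apply: big1 => i _; rewrite mxE tensmxE mxE nej !mul0r.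
have consty x y y' : p (mxtens_index (y, x)) 0 = p (mxtens_index (y', x)) 0.
  apply: (@B_ker_const R (bc_y bc) ny (fun j => p (mxtens_index (j, x)) 0)) => k.
  have := py (mxtens_index (k, x)); rewrite !mxE sum_mxtens_index => pk.
  rewrite -{}[RHS]pk; apply: eq_bigr => j _.
  rewrite (bigD1 x) //= big1 ?addr0 => [|i /negPf nei].
    by rewrite mxE tensmxE mxE eqxx mulr1.
  by rewrite mxE tensmxE mxE nei mulr0 mul0r.
move=> i j; rewrite -(mxtens_unindexK i) -(mxtens_unindexK j).
case: (mxtens_unindex i) (mxtens_unindex j) => [y x] [y' x'].
by rewrite (constx y x x') (consty x' y y').
Qed.

Lemma mean_zero_const_eq0 (R : realFieldType) nx ny (p : 'cV[R]_(ny * nx)) :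
  p \in mean_zero R nx ny -> (forall i j, p i 0 = p j 0) -> p = 0.
Proof.
move=> + pc; rewrite mem_mean_zero /mean_pressure => mp0.
apply/colP => i; rewrite mxE; move: mp0.
(* The index [i] itself witnesses that the grid has a cell. *)
have n0 : (ny * nx)%:R != 0 :> R.
  by rewrite pnatr_eq0 -lt0n (leq_ltn_trans _ (ltn_ord i)).
rewrite (eq_bigr _ (fun j _ => pc j i)) sumr_const card_ord -[p i 0 *+ _]mulr_natr mulfK //.
by move/eqP.
Qed.

Lemma Lc_lker0 (R : realFieldType) bc nx ny (h : R) :
  h != 0 -> lker (Lc bc nx ny h) == 0%VS.
Proof.
move=> h0; rewrite -subv0; apply/subvP => p; rewrite memv_ker memv0 => /eqP.
rewrite /Lc comp_lfunE /divergence opp_lfunE => /eqP; rewrite oppr_eq0.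
move=> /eqP/(congr1 vsval); rewrite val_Gstar gradientE => /mulmx_trmx_ker Gp0.
apply/eqP/val_inj/mean_zero_const_eq0; first exact: subvsP.
exact: Gstar_mx_ker_const h0 Gp0.
Qed.

Theorem mainTheorem3 (R : realFieldType) (bc : boundary_condition)
    (nx ny : nat) (h : R) (nx_ge2 : (2 <= nx)%N) (ny_ge2 : (2 <= ny)%N)
    (h_gt0 : 0 < h) :
  bijective (Lc bc nx ny h) /\
  (P1_inv bc nx ny h \o M_op bc nx ny h)%VF = block_op \1%VF 0 0 \1%VF.
Proof.
have L0 := Lc_lker0 R bc nx ny h (lt0r_neq0 h_gt0).
split.
  by exists (Lc bc nx ny h)^-1%VF; [apply: lker0_lfunK|apply: lker0_lfunVK].
(* [P1_inv] contains the inverse of [- Lc], so the cancellation needs the kernel of that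
   operator. *)
have NL0 : lker (- Lc bc nx ny h) == 0%VS.
  apply/lker0P => p q; rewrite !opp_lfunE => /oppr_inj.
  exact: (elimT lker0P L0).
have inv1 (u : U_space R bc nx ny) : (\1^-1)%VF u = u.
  by rewrite -[u in LHS]id_lfunE lker0_lfunK //; apply/lker0P => x y; rewrite !id_lfunE.
apply/lfunP => -[u p]; rewrite /P1_inv /M_op !comp_lfunE !block_opE /=.
rewrite !(zero_lfunE, id_lfunE, addr0, add0r, inv1, opp_lfunE).
(* The factor [[I 0; -D -I]] sends [(u + G p, - D u)] to second component
   [- D (u + G p) + D u = - Lc p]. Inverting [- Lc] recovers [p], and the last factor subtracts
   [G p] from [u + G p]. *)
have -> : - - Gstar bc nx ny h (u + gradient bc nx ny h p)
          - - - Gstar bc nx ny h u = (- Lc bc nx ny h)%VF p.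
  by rewrite linearD !opp_lfunE comp_lfunE opp_lfunE !opprK addrAC subrr add0r.
by rewrite lker0_lfunK // addrK.
Qed.
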